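(* Let $(T,X,\pi)$ be a topologically weakly-mixing semiflow on a non-singleton compact metric space $(X,d)$ with $T$ an abelian topological semigroup. Then $(T,X,\pi)$ is densely Li-Yorke chaotic.
   Context: A topological semiflow $(T,X,\pi)$ consists of a topological semigroup $T$ (not necessarily discrete), a topological space $X$ and a jointly continuous map $\pi\colon T\times X\to X$, $(t,x)\mapsto tx$, with $s(tx)=(st)x$ for all $s,t\in T$, $x\in X$, and $ex=x$ for all $x$ if $T$ has a neutral element $e$. For nonempty open $U,V\subseteq X$ let $N_T(U,V)=\{t\in T : U\cap t^{-1}V\neq\emptyset\}$, $t^{-1}V=\{x : tx\in V\}$. The semiflow is topologically weakly-mixing if $N_T(U,V)\cap N_T(U',V')\neq\emptyset$ for all nonempty open $U,V,U',V'\subseteq X$ (equivalently, $(T,X\times X)$, with $t(x,y)=(tx,ty)$, is topologically transitive). For an increasing sequence $\mathcal{F}=\{F_n\}_{n\ge1}$ of compact subsets of $T$, a set $S\subseteq X$ is a Li-Yorke chaotic set relative to $\mathcal{F}$ if $S$ is uncountable and for any distinct $x,y\in S$: there is a sequence $\{t_n\}$ in $T$ with $\lim_{n\to\infty}d(t_nx,t_ny)=0$, and there is a sequence $\{s_n\}$ in $T$ with $s_n\in T\setminus F_n$ for all $n$ and $\liminf_{n\to\infty}d(s_nx,s_ny)>0$. $(T,X,\pi)$ is densely Li-Yorke chaotic if for every increasing sequence $\mathcal{F}$ of compact subsets of $T$ there is a Li-Yorke chaotic set relative to $\mathcal{F}$ that is dense in $X$. *)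

(* Defs.v *)
From HB Require Import structures.
From mathcomp Require Import all_boot all_order all_algebra.
From mathcomp Require Import all_classical all_reals all_analysis.

Set Implicit Arguments.
Unset Strict Implicit.
Unset Printing Implicit Defensive.

Import Order.TTheory GRing.Theory Num.Theory.
Import numFieldNormedType.Exports.

Local Open Scope classical_set_scope.
Local Open Scope ring_scope.

(* No separation axiom and no neutral element is assumed. *)
HB.mixin Record Semigroup_hasContinuousMul T of Topological T & Semigroup T := {
  mulg_continuous : continuous (fun p : T * T => (p.1 * p.2)%g)
}.

#[short(type="topologicalSemigroupType")]
HB.structure Definition TopologicalSemigroup :=
  {T of Topological T & Semigroup T & Semigroup_hasContinuousMul T}.

Definition is_neutral (T : semigroupType) (e : T) : Prop :=
  left_id e (fun s t : T => (s * t)%g) /\ right_id e (fun s t : T => (s * t)%g).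

Record semiflow (T : topologicalSemigroupType) (X : topologicalType) := Semiflow {
  semiflow_act :> T -> X -> X;
  semiflow_continuous : continuous (fun p : T * X => semiflow_act p.1 p.2);
  semiflow_actM : forall (s t : T) (x : X),
    semiflow_act s (semiflow_act t x) = semiflow_act (s * t)%g x;
  semiflow_act1 : forall e : T, is_neutral e -> forall x : X, semiflow_act e x = x
}.

Section semiflow_defs.
Context {T : topologicalSemigroupType} {X : topologicalType}.
Variable phi : semiflow T X.

Definition hitting_set (U V : set X) : set T :=
  [set t | U `&` phi t @^-1` V !=set0].

Definition weakly_mixing : Prop :=
  forall U V U' V' : set X,
    open U -> U !=set0 -> open V -> V !=set0 ->
    open U' -> U' !=set0 -> open V' -> V' !=set0 ->
    hitting_set U V `&` hitting_set U' V' !=set0.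

End semiflow_defs.

Section li_yorke.
Context {R : realType} {T : topologicalSemigroupType} {X : metricType R}.
Variable phi : semiflow T X.

(* The liminf is taken in \bar R, where it exists for every sequence. *)
Definition li_yorke_chaotic_set (F : nat -> set T) (S : set X) : Prop :=
  ~ countable S /\
  forall x y : X, S x -> S y -> x <> y ->
    (exists t : nat -> T,
       mdist (phi (t n) x) (phi (t n) y) @[n --> \oo] --> (0 : R)) /\
    (exists s : nat -> T,
       (forall n, (~` F n) (s n)) /\
       (0 < limn_einf (fun n => (mdist (phi (s n) x) (phi (s n) y))%:E))%E).

(* The term F n stands for the (n+1)-st compact set of the sequence. *)
Definition densely_li_yorke_chaotic : Prop :=
  forall F : nat -> set T,
    (forall n, compact (F n)) -> (forall n, F n `<=` F n.+1) ->
    exists S : set X, li_yorke_chaotic_set F S /\ dense S.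

End li_yorke.

(* Main.v *)
Require Import Defs.
From mathcomp Require Import all_boot all_order all_algebra.
From mathcomp Require Import all_classical all_reals all_analysis.
From mathcomp Require Import lra.
From HB Require Import structures.

Import Order.TTheory GRing.Theory Num.Theory.
Import numFieldNormedType.Exports.

Local Open Scope classical_set_scope.

(** By Furstenberg's intersection lemma, commutativity of [T] makes the hitting
sets [N(U, V)] of a weakly mixing semiflow a base of a filter on [T], so any
finite number of them can be hit simultaneously ([mixing_filter_proper]).
Since [X] is compact, this upgrades to: for a nonempty open [U], the image
[tU] is [e]-dense in [X] for all [t] far along this filter
([mixing_filter_image_dense]). A compact [K] in [T] acts equicontinuously, so
for a small [U] the images [tU] with [t] in [K] are small and cannot be
[e]-dense: the filter leaves every compact set ([mixing_filter_avoids_compact]).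

Now fix any point [x]. As [tU] comes close to [tx], every open [U] contains a
[y] with [d(tx, ty)] small. As [tU] also comes close to two fixed points
[a <> b], which cannot both be near [tx], it contains a [y] with
[d(tx, ty) > d(a, b) / 4], and here [t] may be taken outside [F n]. Hence for
every [x], and not merely for generic [x], the points [y] that form a
Li-Yorke pair with [x] contain a countable intersection of dense open sets.

Baire's theorem thus provides, in any nonempty open set, a point related in
this way to all points of a given countable set. Using it along a countable
base gives a dense scrambled set; a maximal scrambled set containing that one
cannot be countable, because Baire's theorem would extend it by one point. *)

(** * Scrambled sets in Baire spaces *)

(** As in a complete metric space, one nests open sets whose closures are
contained in the preceding ones. Regularity makes the shrinking possible, and
a cluster point of any choice of points from these sets lies in all of them. *)
Lemma compact_regular_baire (X : topologicalType) (O : nat -> set X) :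
  compact [set: X] -> regular_space X ->
  (forall n, open (O n) /\ dense (O n)) -> dense (\bigcap_n O n).
Proof.
move=> cX rX oO U U0 oU.
pose good (V : set X) := open V /\ V !=set0.
have shrink (p : nat * set X) :
    exists W, good p.2 -> good W /\ closure W `<=` p.2 `&` O p.1.
  have [[oV V0]|?] := pselect (good p.2); last by exists set0.
  have [x [Vx Ox]] := (oO p.1).2 _ V0 oV.
  have /rX[W Wx cW] : nbhs x (p.2 `&` O p.1).
    by apply: open_nbhs_nbhs; split => //; apply: openI => //; apply: (oO p.1).1.
  exists W°; split.
    by split; [exact: open_interior | exists x].
  by apply: subset_trans cW; apply: closureS; exact: interior_subset.
have [f fP] := choice shrink.
pose V := fix V n := if n is m.+1 then f (m, V m) else U.
have goodV n : good (V n).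
  by elim: n => [|n IH] //=; apply: (fP (n, V n) IH).1.
have clV n : closure (V n.+1) `<=` V n `&` O n := (fP (n, V n) (goodV n)).2.
have VS m n : (m <= n)%N -> V n `<=` V m.
  move=> mn; rewrite -(subnKC mn); elim: (n - m)%N => [|k IH].
    by rewrite addn0.
  rewrite addnS => y Vy; apply: IH.
  by have [] := clV _ _ (subset_closure Vy).
have [x xV] := choice (fun n => (goodV n).2).
have [p [_ clp]] := cX (x @ \oo) _ filterT.
have Vp n : closure (V n.+1) p.
  move=> B Bp; apply: clp Bp; exists n.+1 => // m /= nm; exact: VS nm _ (xV m).
exists p; split; first by have [] := clV _ _ (Vp 0%N).
by move=> n _; have [] := clV _ _ (Vp n).
Qed.

Definition scrambled {X : Type} (P : X -> X -> Prop) (S : set X) : Prop :=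
  forall x y, S x -> S y -> x <> y -> P x y.

(** For every point [x], the relation [P x] holds on the countable intersection
of the dense open sets [O x n]. As this is required at each [x], one use of Baire's
theorem adds a point to any countable scrambled set. *)
Section scrambled_sets.
Context {X : topologicalType} (O : X -> nat -> set X).
Hypothesis baire : forall G : nat -> set X,
  (forall n, open (G n) /\ dense (G n)) -> dense (\bigcap_n G n).
Hypothesis O_open_dense : forall x n, open (O x n) /\ dense (O x n).

Let P x y := forall n, O x n y.

Hypothesis P_sym : forall x y, P x y -> P y x.
Hypothesis P_irr : forall x, ~ P x x.

Lemma exists_related_to_countable (C U : set X) :
  countable C -> open U -> U !=set0 ->
  exists2 y, U y & forall x, C x -> P x y.
Proof.
move=> /pfcard_geP[->|[f]] oU U0; first by have [y Uy] := U0; exists y.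
(* The doubly indexed family [O (f i) n] is listed along an encoding of pairs,
   padded by [setT] at the numbers that encode none. *)
pose G k := if unpickle k is Some (i, n) then O (f i) n else setT.
have [|y [Uy Gy]] := @baire G _ U U0 oU.
  move=> k; rewrite /G; case: unpickle => [[i n]|]; first exact: O_open_dense.
  by split; [exact: openT | move=> W W0 _; rewrite setIT].
exists y => // x Cx n.
have [i _ fix_] := 'surj_f Cx; rewrite -fix_.
by have := Gy (pickle (i, n)) I; rewrite /G pickleK.
Qed.

(** Points are chosen one after the other, the [n]-th in the [n]-th nonempty
member of a countable base, each related to the finitely many earlier ones. *)
Lemma exists_dense_scrambled : @second_countable X ->
  exists2 S : set X, scrambled P S & dense S.
Proof.
move=> [B cB [oB bB]].
have [X0|X0] := pselect ([set: X] !=set0); last first.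
  by exists set0 => // U [x _]; case: X0; exists x.
have [b [bO bB0]] : exists b : nat -> set X,
    (forall n, open (b n) /\ b n !=set0) /\
    forall U, open U -> U !=set0 -> exists n, b n `<=` U.
  have baseE U x : open U -> U x -> exists V, [/\ B V, V x & V `<=` U].
    move=> oU Ux; have [|V [BV Vx] VU] := bB x U; last by exists V.
    exact: open_nbhs_nbhs.
  have : countable (B `&` [set V | V !=set0]).
    by apply: sub_countable cB; exact: subset_card_le.
  move=> /pfcard_geP[B0|[f]].
    have [x _] := X0; have [V [BV Vx _]] := baseE setT x openT I.
    suff : set0 V by [].
    by rewrite -B0; split => //; exists x.
  exists f; split.
    move=> n; have [BV V0] := @funS _ _ _ _ f n I; split => //; exact: oB.
  move=> U oU [x Ux]; have [V [BV Vx VU]] := baseE U x oU Ux.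
  have [|n _ fn] := 'surj_f (_ : (B `&` [set V | V !=set0]) V).
    by split => //; exists x.
  by exists n; rewrite fn.
have ext (p : nat * seq X) :
    exists y, b p.1 y /\ forall x, x \in p.2 -> P x y.
  have cp : countable [set` p.2].
    by apply: finite_set_countable; exact: finite_seq.
  have [y by_ yP] := exists_related_to_countable _ _ cp (bO p.1).1 (bO p.1).2.
  by exists y.
have [s sP] := choice ext.
pose L := fix L n := if n is m.+1 then s (m, L m) :: L m else [::].
have LS m n : (m <= n)%N -> {subset L m <= L n}.
  move=> mn; rewrite -(subnKC mn); elim: (n - m)%N => [|k IH].
    by rewrite addn0.
  by rewrite addnS => y /IH Ly; rewrite /= inE Ly orbT.
exists [set x | exists n, x \in L n].
- have LP n : scrambled P [set` L n].
    elim: n => [//|n IH] x y /=; rewrite !inE.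
    move=> /orP[/eqP->|Lx] /orP[/eqP->|Ly] //.
    + by move=> _; apply/P_sym/(sP (n, L n)).2.
    + by move=> _; apply/(sP (n, L n)).2.
    + exact: IH.
  move=> x y [m Lx] [n Ly]; apply: (LP (maxn m n)) => /=.
    exact: LS (leq_maxl _ _) _ Lx.
  exact: LS (leq_maxr _ _) _ Ly.
- move=> U U0 oU; have [n bU] := bB0 U oU U0.
  exists (s (n, L n)); split; first by apply: bU; apply: (sP (n, L n)).1.
  by exists n.+1; rewrite /= inE eqxx.
Qed.

(** Zorn's lemma is applied to the sets whose union with a fixed dense scrambled
set is scrambled. If a maximal such union were countable, some point would be
related to all of its points; it lies outside since [P] is irreflexive, so it
could be added. *)
Lemma exists_dense_uncountable_scrambled :
  @second_countable X -> [set: X] !=set0 ->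
  exists S : set X, [/\ ~ countable S, dense S & scrambled P S].
Proof.
move=> scX X0; have [S0 S0P dS0] := exists_dense_scrambled scX.
have [F FP totF|S [SP Smax]] := @Zorn_bigcup X (fun S => scrambled P (S0 `|` S)).
  move=> x y [S0x|[A FA Ax]] [S0y|[B FB By]].
  - exact: S0P.
  - by apply: (FP _ FB); [left|right].
  - by apply: (FP _ FA); [right|left].
  - have [AB|BA] := totF _ _ FA FB.
    + by apply: (FP _ FB); right => //; exact: AB.
    + by apply: (FP _ FA); right => //; exact: BA.
exists (S0 `|` S); split => //; last first.
  by move=> U U0 oU; have [x [Ux Sx]] := dS0 U U0 oU; exists x; split => //; left.
move=> cS; have [y _ yP] := @exists_related_to_countable _ setT cS openT X0.
have nSy : ~ S y by move=> Sy; apply: (@P_irr y); apply: yP; right.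
apply: (Smax (y |` S)).
  by split; [exact: subsetUr | move=> /(_ y (or_introl erefl))].
rewrite setUCA => x z [->|Sx] [->|Sz] //.
- by move=> _; apply/P_sym/yP.
- by move=> _; apply/yP.
- exact: SP.
Qed.

End scrambled_sets.

(** * The filter of hitting sets *)

Section mixing_filter.
Context {T : topologicalSemigroupType} {X : topologicalType}.
Variable phi : semiflow T X.
Hypothesis T_abelian : commutative (fun s t : T => (s * t)%g).
Hypothesis phi_wm : weakly_mixing phi.

Lemma semiflow_actC s t x : phi s (phi t x) = phi t (phi s x).
Proof. by rewrite !semiflow_actM T_abelian. Qed.

Lemma continuous_act t : continuous (phi t).
Proof.
move=> x.
apply: (@continuous_comp _ _ _ (fun y => (t, y)) (fun p : T * X => phi p.1 p.2)).
  by apply: cvg_pair; [exact: cvg_cst | exact: cvg_id].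
exact: semiflow_continuous.
Qed.

Definition mixing_filter : set_system T :=
  filter_from [set p : set X * set X |
    [/\ open p.1, p.1 !=set0, open p.2 & p.2 !=set0]]
    (fun p => hitting_set phi p.1 p.2).

Lemma mixing_filter_hitting U V : open U -> U !=set0 -> open V -> V !=set0 ->
  \forall t \near mixing_filter, hitting_set phi U V t.
Proof. by move=> oU U0 oV V0; exists (U, V). Qed.

(** Furstenberg's intersection lemma: if [s] hits both [(U, U')] and [(V, V')],
put [U'' := U] intersected with [s^-1 U'] and [V'' := V] intersected with
[s^-1 V']. An orbit from [U''] to [V''] under [t] goes from [U] to [V], and its
translate by [s] goes from [U'] to [V'] since [s] and [t] commute. *)
Lemma mixing_filter_proper : [set: X] !=set0 -> ProperFilter mixing_filter.
Proof.
move=> X0; apply: filter_from_proper; last first.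
  move=> [U V] [oU U0 oV V0].
  by have [t [t1 _]] := phi_wm _ _ _ _ oU U0 oV V0 oU U0 oV V0; exists t.
apply: filter_from_filter.
  by exists (setT, setT); split => //; exact: openT.
move=> [U V] [U' V'] /= [oU U0 oV V0] [oU' U'0 oV' V'0].
have [s [UU' VV']] := phi_wm _ _ _ _ oU U0 oU' U'0 oV V0 oV' V'0.
have open_act W : open W -> open (phi s @^-1` W).
  by move=> oW; apply: open_comp => // x _; exact: continuous_act.
exists (U `&` phi s @^-1` U', V `&` phi s @^-1` V').
  by split => //; apply: openI => //; exact: open_act.
move=> t [x [[Ux U'sx] [Vtx V'stx]]]; split; first by exists x.
by exists (phi s x); split => //; rewrite /preimage/= semiflow_actC.
Qed.

End mixing_filter.

Local Open Scope ring_scope.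

(** * Metric consequences of weak mixing *)

Lemma mdist_continuous {R : realType} {X : metricType R} (u : X) :
  continuous (fun v => mdist u v : R).
Proof.
move=> v; apply/cvgrPdist_lt => e e0.
have : nbhs v (ball v e) by exact: nbhsx_ballx.
apply: filterS => w; rewrite ballEmdist/= => vw.
rewrite (le_lt_trans _ vw)// ler_norml.
have := metric_triangle u w v; have := metric_triangle u v w.
by rewrite (metric_sym w v); lra.
Qed.

Section metric_semiflow.
Context {R : realType} {T : topologicalSemigroupType} {X : metricType R}.
Variable phi : semiflow T X.
Hypothesis T_abelian : commutative (fun s t : T => (s * t)%g).
Hypothesis X_compact : compact [set: X].
Hypothesis phi_wm : weakly_mixing phi.

(** Near a given [z0], it suffices that [t] hits the ball around [z0] from [U];
compactness of [X] reduces all [z] to finitely many such conditions, which hold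
together along the filter. *)
Lemma mixing_filter_image_dense (U : set X) (e : R) :
  open U -> U !=set0 -> 0 < e ->
  \forall t \near mixing_filter phi,
    forall z, exists2 y, U y & mdist z (phi t y) < e.
Proof.
move=> oU U0 e0.
have X0 : [set: X] !=set0 by have [x _] := U0; exists x.
have PF := mixing_filter_proper _ T_abelian phi_wm X0.
have e20 : 0 < e / 2 by rewrite divr_gt0.
have : \forall t \near mixing_filter phi,
    [set: X] `<=` [set z | exists2 y, U y & mdist z (phi t y) < e].
  move/compact_near_coveringP: X_compact; apply => z0 _ /=.
  have nb : nbhs z0 (ball z0 (e / 2)) by exact: nbhsx_ballx.
  exists (ball z0 (e / 2), hitting_set phi U (ball z0 (e / 2))°) => /=.
    split => //; apply: mixing_filter_hitting => //; first exact: open_interior.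
    by exists z0.
  move=> [z t] /= [] z0z [y [Uy /interior_subset z0ty]]; exists y => //.
  move: z0z z0ty; rewrite !ballEmdist/= (metric_sym z0 z) => ? ?.
  by have := metric_triangle z z0 (phi t y); lra.
by apply: filterS => t H z; exact: H.
Qed.

Lemma compact_equicontinuous (K : set T) (x : X) (e : R) : compact K -> 0 < e ->
  \forall y \near x, forall t, K t -> mdist (phi t x) (phi t y) < e.
Proof.
move=> cK e0.
have e20 : 0 < e / 2 by rewrite divr_gt0.
move/compact_near_coveringP: cK.
move=> /(_ _ (nbhs x) (fun y t => mdist (phi t x) (phi t y) < e)); apply => t _.
have nb : nbhs (phi t x) (ball (phi t x) (e / 2)) by exact: nbhsx_ballx.
have [[A B] /= [At Bx] AB] := @semiflow_continuous _ _ phi (t, x) _ nb.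
exists (A, B) => // -[t' y] /= [At' By].
have := AB (t', y) (conj At' By).
have := AB (t', x) (conj At' (nbhs_singleton Bx)).
rewrite /= !ballEmdist/= (metric_sym (phi t x) (phi t' x)) => ? ?.
by have := metric_triangle (phi t' x) (phi t x) (phi t' y); lra.
Qed.

(** If [t] is in [K], then [t] maps a small neighbourhood of [a] into a ball of
radius [d(a, b) / 4] around [ta]; an image that is also [d(a, b) / 4]-dense
would make [d(a, b)] smaller than itself. *)
Lemma mixing_filter_avoids_compact (K : set T) : compact K ->
  (exists a b : X, a <> b) -> \forall t \near mixing_filter phi, ~ K t.
Proof.
move=> cK [a [b ab]].
have PF : ProperFilter (mixing_filter phi).
  by apply: mixing_filter_proper => //; exists a.
pose d : R := mdist a b / 4.
have d0 : 0 < d by rewrite divr_gt0// mdist_gt0; exact/eqP.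
have /nbhs_interior nW := compact_equicontinuous K a d cK d0.
have := mixing_filter_image_dense _ d (open_interior _)
  (ex_intro _ a (nbhs_singleton nW)) d0.
apply: filterS => t tW Kt.
have [y /interior_subset/(_ t Kt) ty aty] := tW a.
have [z /interior_subset/(_ t Kt) tz btz] := tW b.
have := metric_triangle a (phi t y) b.
have := metric_triangle (phi t y) (phi t a) b.
have := metric_triangle (phi t a) (phi t z) b.
rewrite (metric_sym (phi t y) (phi t a)) (metric_sym (phi t z) b).
by move: ty aty tz btz; rewrite /d; lra.
Qed.

Lemma open_bigcup_dist (A : set T) (V : set R) (x : X) : open V ->
  open (\bigcup_(t in A) [set y | V (mdist (phi t x) (phi t y))]).
Proof.
move=> oV; apply: bigcup_open => t _.
apply: (@open_comp _ _ (phi t) (mdist (phi t x) @^-1` V)) => [y _|].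
  exact: continuous_act.
by apply: open_comp => // y _; exact: mdist_continuous.
Qed.

(** [tU] is [e]-dense for some [t], so it has a point close to [tx]. *)
Lemma dense_close_pairs (x : X) (e : R) : 0 < e ->
  dense (\bigcup_t [set y | mdist (phi t x) (phi t y) < e]).
Proof.
move=> e0 U U0 oU.
have PF : ProperFilter (mixing_filter phi).
  by apply: mixing_filter_proper => //; exists x.
have [t /(_ (phi t x))[y Uy ty]] :=
  filter_ex (mixing_filter_image_dense U e oU U0 e0).
by exists y; split => //; exists t.
Qed.

(** For a suitable [t] outside [K], the image [tU] contains points within
[d(a, b) / 4] of [a] and of [b]. These two points are more than [d(a, b) / 2]
apart, so one of them is more than [d(a, b) / 4] away from [tx]. *)
Lemma dense_far_pairs (K : set T) (x a b : X) : compact K -> a <> b ->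
  dense (\bigcup_(t in ~` K)
    [set y | mdist a b / 4 < mdist (phi t x) (phi t y)]).
Proof.
move=> cK ab U U0 oU.
have PF : ProperFilter (mixing_filter phi).
  by apply: mixing_filter_proper => //; exists x.
have d0 : 0 < mdist a b / 4 by rewrite divr_gt0// mdist_gt0; exact/eqP.
have [t [nKt tU]] := filter_ex (filterI
  (mixing_filter_avoids_compact K cK (ex_intro _ a (ex_intro _ b ab)))
  (mixing_filter_image_dense U _ oU U0 d0)).
have [y Uy aty] := tU a; have [z Uz btz] := tU b.
have [ty|ty] := ltP (mdist a b / 4) (mdist (phi t x) (phi t y)).
  by exists y; split => //; exists t.
exists z; split => //; exists t => //=.
have := metric_triangle a (phi t y) b.
have := metric_triangle (phi t y) (phi t x) b.
have := metric_triangle (phi t x) (phi t z) b.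
rewrite (metric_sym (phi t y) (phi t x)) (metric_sym (phi t z) b).
by move: ty aty btz d0; lra.
Qed.

End metric_semiflow.

(** * Li-Yorke chaos *)

Lemma compact_metric_second_countable {R : realType} {X : metricType R} :
  compact [set: X] -> @second_countable X.
Proof.
have [[x _]|X0] := pselect ([set: X] !=set0); last first.
  move=> _; exists set0; first exact: countable0.
  by split => // x; case: X0; exists x.
(* Any point of the nonempty space serves as its base point. *)
pose Xp : pseudoPMetricType R := HB.pack (X : Type) X (isPointed.Build X x).
exact: (@compact_second_countable R Xp).
Qed.

Lemma limn_einf_gt0 {R : realType} (u : nat -> R) (e : R) :
  0 < e -> (forall n, e < u n) -> (0 < limn_einf (EFin \o u))%E.
Proof.
move=> e0 eu; apply: (@lt_le_trans _ _ e%:E); first by rewrite lte_fin.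
rewrite limn_einf_lim; apply: lime_ge; first exact: is_cvg_einfs.
apply: nearW => n; apply: le_ereal_inf_tmp => _ [k _ <-].
by rewrite lee_fin ltW.
Qed.

Theorem proposition3p22 (R : realType) (T : topologicalSemigroupType)
    (X : metricType R) (phi : semiflow T X)
    (T_abelian : commutative (fun s t : T => (s * t)%g))
    (X_compact : compact [set: X])
    (X_nonsingleton : exists x y : X, x <> y)
    (phi_wm : weakly_mixing phi) :
  densely_li_yorke_chaotic phi.
Proof.
move=> F cF _; have [a [b ab]] := X_nonsingleton.
have d0 : 0 < mdist a b / 4 :> R by rewrite divr_gt0// mdist_gt0; exact/eqP.
(* Membership in both parts for all [n] makes a Li-Yorke pair; the single lower
   bound d(a, b) / 4 for all [n] is what makes the lower limit positive. *)
pose O (x : X) n :=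
  \bigcup_t [set y | (mdist (phi t x) (phi t y) : R) < n.+1%:R^-1] `&`
  \bigcup_(t in ~` F n) [set y | mdist a b / 4 < mdist (phi t x) (phi t y)].
have oclose (x : X) (e : R) :
    open (\bigcup_t [set y | (mdist (phi t x) (phi t y) : R) < e]).
  exact: (open_bigcup_dist phi setT [set r | r < e] x (@open_lt R e)).
have [||||||S [nS dS SP]] := @exists_dense_uncountable_scrambled X O.
- move=> G; apply: compact_regular_baire => //; exact: uniform_regular.
- move=> x n; split.
    apply: openI; first exact: oclose.
    exact: (open_bigcup_dist phi _ [set r | _ < r] x (@open_gt R _)).
  apply: denseI; first exact: oclose.
    by apply: dense_close_pairs => //; rewrite invr_gt0.
  exact: dense_far_pairs.
- move=> x y xy n; have [[t At txy] [s As sxy]] := xy n.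
  split; first by exists t => //; rewrite /= (metric_sym (phi t y)).
  by exists s => //; rewrite /= (metric_sym (phi s y)).
- move=> x /(_ 0%N)[_ [t _]]; rewrite /= mdistxx => h.
  by move: (lt_trans d0 h); rewrite ltxx.
- exact: compact_metric_second_countable.
- by exists a.
exists S; split => //; split => // x y Sx Sy xy.
have Oxy := SP x y Sx Sy xy.
split.
  have /choice[t tP] n : exists t,
      (mdist (phi t x) (phi t y) : R) < n.+1%:R^-1.
    by have [[t _ txy] _] := Oxy n; exists t.
  exists t; apply: (@squeeze_cvgr _ _ _ _ (cst 0) (@harmonic R)).
  - by apply: nearW => n; rewrite /= mdist_ge0 /= ltW.
  - exact: cvg_cst.
  - exact: cvg_harmonic.
have /choice[s sP] n : exists s, (~` F n) s /\
    mdist a b / 4 < mdist (phi s x) (phi s y).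
  by have [_ [s Fs sxy]] := Oxy n; exists s.
exists s; split; first by move=> n; have [] := sP n.
apply: (@limn_einf_gt0 R (fun n => mdist (phi (s n) x) (phi (s n) y)) _ d0).
by move=> n; have [] := sP n.
Qed.
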